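(* Let $\{K_j\}_{j=1}^m$ be a clique cover of a finite graph on the node set $[n]$, and let $\mathcal{C}=\{\mathbf{x}\in[0,1]^{n+m} \mid \sum_{i\in\bar K_j}x_i=1,\ j\in[m]\}$. Then the mapping $\mathcal{P}$ defined by the truncation projection algorithm (see context) is a projection to $\mathcal{C}$; that is, $\mathcal{P}$ is a mapping $\mathbb{R}^{n+m}_{\ge 0}\to\mathcal{C}$ that is idempotent ($\mathcal{P}(\mathcal{P}(\mathbf{x}))=\mathcal{P}(\mathbf{x})$ for all $\mathbf{x}$) and continuous.
   Context: Notation: $[k]=\{1,\dots,k\}$. Let $\mathcal{G}=(\mathcal{V},\mathcal{E})$ be a finite undirected graph with $\mathcal{V}=[n]$. A clique cover is a family of subsets $K_j\subseteq\mathcal{V}$, $j\in[m]$, each inducing a complete subgraph (clique) of $\mathcal{G}$, that covers all edges and nodes: $\mathcal{E}=\bigcup_{j}\{\{i,i'\}\mid i,i'\in K_j,\ i\neq i'\}$ and $\mathcal{V}=\bigcup_j K_j$. For each clique introduce a slack index $n+j$ and put $\bar K_j=K_j\cup\{n+j\}$. For $i\in[n]$ let $J_i=\{j\in[m]\mid i\in\bar K_j\}$. Projection: a mapping $\mathcal{P}\colon\mathbb{R}^{n+m}_{\ge0}\to\mathcal{C}$ is called a projection if it is idempotent and continuous. Truncation projection algorithm. Input: $\mathbf{x}\in\mathbb{R}^{n+m}_{\ge 0}$. Initialize $\hat x_i:=0$ for $i\in[n]$ and $\hat x_{n+j}:=1$ for $j\in[m]$. Then for $i=1,\dots,n$ in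 order: set $M:=\min_{j\in J_i}\hat x_{n+j}$; set $\hat x_i:=\min\{x_i,M\}$; for every $j\in J_i$ set $\hat x_{n+j}:=\hat x_{n+j}-\hat x_i$. Output: $\mathcal{P}(\mathbf{x}):=\hat{\mathbf{x}}$. *)

(* Defs.v *)
From mathcomp Require Import all_boot all_order all_algebra.
From mathcomp Require Import all_classical all_reals all_analysis.

Set Implicit Arguments.
Unset Strict Implicit.
Unset Printing Implicit Defensive.

Import Order.TTheory GRing.Theory Num.Theory.
Import numFieldNormedType.Exports.

Local Open Scope ring_scope.

Section Graphs.
Local Open Scope set_scope.
Variables n m : nat.
Implicit Types (E : {set {set 'I_n}}) (K : 'I_m -> {set 'I_n}).

Definition edge_set E := forall e, e \in E -> #|e| = 2%N.

Definition clique E (A : {set 'I_n}) :=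
  forall i i', i \in A -> i' \in A -> i != i' -> [set i; i'] \in E.

Definition clique_cover E K :=
  [/\ forall j, clique E (K j),
      E = \bigcup_(j < m) [set [set i; i'] | i in K j, i' in K j & i != i']
    & [set: 'I_n] = \bigcup_(j < m) K j].

(* Coordinates 'I_(n + m): node i is lshift m i, the slack of clique j is
   rshift n j. *)
Definition Kbar K (j : 'I_m) : {set 'I_(n + m)} :=
  rshift n j |: [set lshift m i | i in K j].

Definition Jset K (i : 'I_n) : {set 'I_m} :=
  [set j | lshift m i \in Kbar K j].

End Graphs.

Section Truncation.
Variables (R : realType) (n m : nat).
Implicit Types (K : 'I_m -> {set 'I_n}) (x y : 'rV[R]_(n + m)).

(* Seeding the iterated minimum with a value f j0, j0 \in A, makes it the
   exact minimum of f over A whenever A is nonempty (see fminP); the value 0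
   on the empty set is a dummy, as every node lies in some clique. *)
Definition fmin (T : finType) (A : {set T}) (f : T -> R) : R :=
  if [pick j in A] is Some j0 then \big[Num.min/f j0]_(j in A) f j else 0.

Lemma fminP (T : finType) (A : {set T}) (f : T -> R) : A != finset.set0 ->
  (exists2 j, j \in A & fmin A f = f j) /\ (forall j, j \in A -> fmin A f <= f j).
Proof.
rewrite /fmin; case: pickP => [j0 Aj0 _|A0]; last first.
  by case/set0Pn => j Aj; rewrite A0 in Aj.
split; last by move=> j Aj; exact: bigmin_le_cond.
apply: (big_ind (fun v => exists2 j, j \in A & v = f j)).
- by exists j0.
- move=> u v [j Aj ->] [k Ak ->]; case: (leP (f j) (f k)) => _.
    by exists j.
  by exists k.
- by move=> j Aj; exists j.
Qed.

Definition truncation_init : 'rV[R]_(n + m) :=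
  row_mx (const_mx 0) (const_mx 1).

Definition truncation_step K x y (i : 'I_n) : 'rV[R]_(n + m) :=
  let M := fmin (Jset K i) (fun j => y 0 (rshift n j)) in
  let t := Num.min (x 0 (lshift m i)) M in
  row_mx
    (\row_(i' < n) (if i' == i then t else y 0 (lshift m i')))
    (\row_(j < m) (if j \in Jset K i then y 0 (rshift n j) - t
                   else y 0 (rshift n j))).

(* enum 'I_n lists 0, ..., n.-1 in increasing order. *)
Definition truncation K x : 'rV[R]_(n + m) :=
  foldl (truncation_step K x) truncation_init (enum 'I_n).

Local Open Scope classical_set_scope.

Definition nonneg_orthant (d : nat) : set 'rV[R]_d :=
  [set x : 'rV[R]_d | forall k, 0 <= x 0 k].

Definition clique_polytope K : set 'rV[R]_(n + m) :=
  [set x | (forall k, 0 <= x 0 k <= 1) /\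
           (forall j, \sum_(k in Kbar K j) x 0 k = 1)].

(* P is used only on the nonnegative orthant; its values elsewhere are
   irrelevant. *)
Definition is_projection (d : nat) (C : set 'rV[R]_d)
    (P : 'rV[R]_d -> 'rV[R]_d) :=
  [/\ forall x : 'rV[R]_d, nonneg_orthant x -> C (P x),
      forall x : 'rV[R]_d, nonneg_orthant x -> P (P x) = P x
    & {within @nonneg_orthant d, continuous P}].

End Truncation.

(* Main.v *)
Require Import Defs.
From mathcomp Require Import all_boot all_order all_algebra.
From mathcomp Require Import all_classical all_reals all_analysis.

(** The equations of the polytope hold for the initial vector, and each step
    moves an amount [t] from the slacks of the cliques through node [i] to the
    coordinate of [i], which keeps every clique sum equal to 1; truncating at
    the smallest slack keeps the slacks nonnegative. On a point of the polytope
    no truncation ever happens, because the slack left in each clique is at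
    least the sum of the coordinates still to be processed; so the algorithm
    copies the point. Continuity holds because each step is composed of minima
    and subtractions. *)

Set Implicit Arguments.
Unset Strict Implicit.
Unset Printing Implicit Defensive.

Import Order.TTheory GRing.Theory Num.Theory.
Import numFieldNormedType.Exports.

Local Open Scope ring_scope.

Lemma in_Jset (n m : nat) (K : 'I_m -> {set 'I_n}) (i : 'I_n) (j : 'I_m) :
  (j \in Jset K i) = (i \in K j).
Proof.
by rewrite !inE eq_lrshift /= mem_imset //; exact: lshift_inj.
Qed.

(** Ensures that the minimum in each step runs over a nonempty set, so the dummy value of [fmin]
    never occurs. *)
Lemma clique_cover_Jset (n m : nat) (E : {set {set 'I_n}})
    (K : 'I_m -> {set 'I_n}) (i : 'I_n) :
  clique_cover E K -> exists j, j \in Jset K i.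
Proof.
case=> _ _ cov; have : i \in finset.setT by rewrite inE.
by rewrite cov => /bigcupP[j _ Kji]; exists j; rewrite in_Jset.
Qed.

Section Polytope.
Variables (R : realType) (n m : nat) (K : 'I_m -> {set 'I_n}).
Implicit Types (x y : 'rV[R]_(n + m)) (s : seq 'I_n).

Lemma sum_Kbar x (j : 'I_m) :
  \sum_(k in Kbar K j) x 0 k =
  x 0 (rshift n j) + \sum_(i in K j) x 0 (lshift m i).
Proof.
rewrite big_setU1 /=; last first.
  by apply/imsetP => -[i _ /eqP]; rewrite eq_rlshift.
by rewrite big_imset //= => i i' _ _; exact: lshift_inj.
Qed.

Hypothesis cov : forall i, exists j, j \in Jset K i.

(** The upper bound is automatic: every coordinate is one of the nonnegative terms of some clique
    sum, whose value is 1. *)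
Lemma clique_polytopeP x : (forall k, 0 <= x 0 k) ->
  (forall j, \sum_(k in Kbar K j) x 0 k = 1) -> clique_polytope K x.
Proof.
move=> x0 x1; split=> // k; rewrite x0 /=.
have [j kj] : exists j, k \in Kbar K j.
  case: (split_ordP k) => [i ->|j ->]; last by exists j; rewrite !inE eqxx.
  by have [j] := cov i; rewrite inE; exists j.
by rewrite -(x1 j) (bigD1 k) //= lerDl sumr_ge0.
Qed.

Lemma truncation_init_polytope : clique_polytope K (truncation_init R n m).
Proof.
apply: clique_polytopeP => [k|j].
  by case: (split_ordP k) => [i ->|j ->]; rewrite ?row_mxEl ?row_mxEr mxE.
rewrite sum_Kbar row_mxEr mxE big1 ?addr0 // => i _.
by rewrite row_mxEl mxE.
Qed.

Definition truncation_amount x y (i : 'I_n) : R :=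
  Num.min (x 0 (lshift m i)) (fmin (Jset K i) (fun j => y 0 (rshift n j))).

Lemma truncation_stepl x y (i i' : 'I_n) :
  truncation_step K x y i 0 (lshift m i') =
  if i' == i then truncation_amount x y i else y 0 (lshift m i').
Proof. by rewrite row_mxEl mxE. Qed.

Lemma truncation_stepr x y (i : 'I_n) (j : 'I_m) :
  truncation_step K x y i 0 (rshift n j) =
  if i \in K j then y 0 (rshift n j) - truncation_amount x y i
  else y 0 (rshift n j).
Proof. by rewrite row_mxEr mxE in_Jset. Qed.

Lemma truncation_amount_ge0 x y (i : 'I_n) :
  0 <= x 0 (lshift m i) -> (forall j, 0 <= y 0 (rshift n j)) ->
  0 <= truncation_amount x y i.
Proof.
move=> xi0 y0; rewrite /truncation_amount le_min xi0 /= /fmin.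
by case: pickP => // j0 _; apply: le_bigmin.
Qed.

Lemma truncation_amount_le x y (i : 'I_n) (j : 'I_m) :
  i \in K j -> truncation_amount x y i <= y 0 (rshift n j).
Proof.
rewrite -in_Jset => ij; apply: (@le_trans _ _ (fmin (Jset K i) (fun j => y 0 (rshift n j)))).
  by rewrite /truncation_amount ge_min lexx orbT.
have /(@fminP R _ _ (fun j => y 0 (rshift n j)))[_] : Jset K i != finset.set0.
  by apply/set0Pn; exists j.
by apply.
Qed.

(** The step overwrites coordinate [i] instead of adding to it; the clique sums survive because that
    coordinate was 0. *)
Lemma truncation_step_polytope x y (i : 'I_n) :
  nonneg_orthant x -> clique_polytope K y -> y 0 (lshift m i) = 0 ->
  clique_polytope K (truncation_step K x y i).
Proof.
move=> x0 [yb y1] yi0.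
have y0 k : 0 <= y 0 k by case/andP: (yb k).
apply: clique_polytopeP => [k|j].
  case: (split_ordP k) => [i' ->|j ->].
    by rewrite truncation_stepl; case: eqP => // _; exact: truncation_amount_ge0.
  rewrite truncation_stepr; case: ifP => // ij.
  by rewrite subr_ge0 truncation_amount_le.
rewrite -(y1 j) !sum_Kbar truncation_stepr; case: ifP => ij; last first.
  congr (_ + _); apply: eq_bigr => i' i'j; rewrite truncation_stepl.
  by case: eqP => // ii'; rewrite -ii' i'j in ij.
rewrite (bigD1 i) //= truncation_stepl eqxx addrA subrK.
rewrite [in RHS](bigD1 i) //= yi0 add0r; congr (_ + _).
by apply: eq_bigr => i' /andP[_ /negPf ii']; rewrite truncation_stepl ii'.
Qed.

(** The invariant is that nodes still to be visited have coordinate 0; [uniq s] prevents a second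
    visit to a node already set. *)
Lemma truncation_foldl_polytope x y s : nonneg_orthant x -> uniq s ->
  clique_polytope K y -> (forall i, i \in s -> y 0 (lshift m i) = 0) ->
  clique_polytope K (foldl (truncation_step K x) y s).
Proof.
move=> x0; elim: s y => //= i s IHs y /andP[iNs us] Cy ys0.
apply: IHs => // [|i' i's].
  by apply: truncation_step_polytope; rewrite ?ys0 ?mem_head.
rewrite truncation_stepl; case: eqP => [ii'|_]; last by rewrite ys0 ?inE ?i's ?orbT.
by rewrite -ii' i's in iNs.
Qed.

Lemma truncation_polytope x :
  nonneg_orthant x -> clique_polytope K (truncation K x).
Proof.
move=> x0; apply: truncation_foldl_polytope => //.
- exact: enum_uniq.
- exact: truncation_init_polytope.
- by move=> i _; rewrite row_mxEl mxE.
Qed.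

(** Closed form of the state reached on a polytope point [x] after the nodes of [s] have been copied
    without truncation. *)
Definition truncation_prefix x s : 'rV[R]_(n + m) :=
  row_mx (\row_i (if i \in s then x 0 (lshift m i) else 0))
         (\row_j (1 - \sum_(i in K j | i \in s) x 0 (lshift m i))).

Lemma truncation_prefix_amount x s (i : 'I_n) : clique_polytope K x ->
  i \notin s -> truncation_amount x (truncation_prefix x s) i = x 0 (lshift m i).
Proof.
move=> [xb x1] iNs; have x0 k : 0 <= x 0 k by case/andP: (xb k).
apply: min_l; have [j0 ij0] := cov i.
(* The minimum is attained at some clique [j] through [i], so only one slack has to be bounded
   below. *)
have /(@fminP R _ _ (fun j => truncation_prefix x s 0 (rshift n j)))[[j ij ->] _]
  : Jset K i != finset.set0 by apply/set0Pn; exists j0.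
(* Write 1 as the clique sum of [x]: the part over [s] cancels, leaving the slack of [x] plus the
   unprocessed nodes of [K j], among them [i]. *)
rewrite in_Jset in ij; rewrite row_mxEr mxE -(x1 j) sum_Kbar.
rewrite (bigID (mem s)) /= addrCA addrAC subrr add0r.
rewrite (bigD1 i) ?ij //= addrCA lerDl addr_ge0 //.
by apply: sumr_ge0.
Qed.

Lemma truncation_step_prefix x s (i : 'I_n) : clique_polytope K x ->
  i \notin s ->
  truncation_step K x (truncation_prefix x s) i =
  truncation_prefix x (rcons s i).
Proof.
move=> Cx iNs; apply/rowP => k; case: (split_ordP k) => [i' ->|j ->].
  rewrite truncation_stepl truncation_prefix_amount // !row_mxEl !mxE.
  by rewrite mem_rcons inE; case: eqP => [->|].
rewrite truncation_stepr truncation_prefix_amount // !row_mxEr !mxE.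
case: ifP => ij.
  rewrite -addrA -opprD; congr (_ - _).
  rewrite [in RHS](bigD1 i) /= ?ij ?mem_rcons ?mem_head // addrC.
  congr (_ + _); apply: eq_bigl => i'; rewrite mem_rcons inE.
  by case: eqP => [->|_]; rewrite ?(negPf iNs) ?andbF ?andbT.
congr (_ - _); apply: eq_bigl => i'; rewrite mem_rcons inE.
by case: eqP => [->|_] //; rewrite ij.
Qed.

Lemma truncation_foldl_prefix x s : clique_polytope K x -> uniq s ->
  foldl (truncation_step K x) (truncation_init R n m) s =
  truncation_prefix x s.
Proof.
(* Induction from the right, so that the last step acts on the state of the prefix before it. *)
move=> Cx; elim/last_ind: s => [|s i IHs].
  move=> _; apply/rowP => k; case: (split_ordP k) => [i ->|j ->].
    by rewrite !row_mxEl !mxE.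
  by rewrite !row_mxEr !mxE big_pred0 ?subr0 // => i; rewrite andbF.
rewrite rcons_uniq foldl_rcons => /andP[iNs us].
by rewrite IHs // truncation_step_prefix.
Qed.

Lemma truncation_id x : clique_polytope K x -> truncation K x = x.
Proof.
move=> Cx; rewrite /truncation truncation_foldl_prefix ?enum_uniq //.
apply/rowP => k; case: (split_ordP k) => [i ->|j ->].
  by rewrite row_mxEl mxE mem_enum.
(* With all nodes processed, the clique equation identifies the remaining slack with that of [x]. *)
rewrite row_mxEr mxE; case: Cx => _ /(_ j) <-; rewrite sum_Kbar.
rewrite [X in _ - X](eq_bigl (mem (K j))) ?addrK // => i.
by rewrite mem_enum andbT.
Qed.

End Polytope.

Section Continuity.
Local Open Scope classical_set_scope.

(** A neighbourhood of a matrix contains a product of neighbourhoods of its entries; these are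
    finitely many, so their preimages intersect in a neighbourhood. *)
Lemma continuous_mx (T U : topologicalType) (p q : nat) (f : T -> 'M[U]_(p, q)) :
  (forall i j, continuous (fun t => f t i j)) -> continuous f.
Proof.
move=> cf t A [P Pft sPA]; rewrite nbhs_filterE /=.
apply: (@filterS _ (nbhs t) _
  [set u | forall ij : 'I_p * 'I_q, P ij.1 ij.2 (f u ij.1 ij.2)]).
  by move=> u Pu; apply: sPA => i j; exact: (Pu (i, j)).
by apply: filter_forall => -[i j] /=; exact/cf/Pft.
Qed.

Lemma continuous_minr (R : realType) (T : topologicalType) (f g : T -> R) :
  continuous f -> continuous g -> continuous (fun t => Num.min (f t) (g t)).
Proof. by move=> cf cg t; exact: (continuous_min (cf t) (cg t)). Qed.

Lemma continuous_fmin (R : realType) (T : topologicalType) (I : finType)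
    (A : {set I}) (f : T -> I -> R) :
  (forall i, continuous (f^~ i)) -> continuous (fun t => fmin A (f t)).
Proof.
(* The picked index depends on [A] alone, so the seed is the same continuous function for all
   [t]. *)
move=> cf; rewrite /fmin; case: pickP => [i0 _|_]; last exact: cst_continuous.
elim: (index_enum I) => [|i s IHs].
  by under eq_fun do rewrite big_nil; exact: cf.
under eq_fun do rewrite big_cons; case: (i \in A) => //=.
by apply: continuous_minr => //; exact: cf.
Qed.

Variables (R : realType) (n m : nat) (K : 'I_m -> {set 'I_n}).

(** Input and state both vary with [t], since along the fold the state is itself a function of the
    input. *)
Lemma truncation_step_continuous (T : topologicalType)
    (f g : T -> 'rV[R]_(n + m)) (i : 'I_n) :
  continuous f -> continuous g ->
  continuous (fun t => truncation_step K (f t) (g t) i).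
Proof.
move=> cf cg.
have coord (h : T -> 'rV[R]_(n + m)) k : continuous h -> continuous (fun t => h t 0 k).
  move=> ch t.
  exact: (continuous_comp (ch t) (@coord_continuous R 1 (n + m) 0 k (h t))).
have camount : continuous (fun t => truncation_amount K (f t) (g t) i).
  apply: continuous_minr; first exact: coord.
  by apply: continuous_fmin => j; exact: coord.
apply: continuous_mx => r k; rewrite (ord1 r).
(* The branch taken in each coordinate depends on the indices only, never on [t]. *)
case: (split_ordP k) => [i' ->|j ->].
  under eq_fun do rewrite truncation_stepl.
  by case: (i' == i) => //=; exact: coord.
under eq_fun do rewrite truncation_stepr.
case: (i \in K j) => /=; last exact: coord.
by move=> t; apply: cvgB; [exact: coord|exact: camount].
Qed.

Lemma truncation_continuous : continuous (@truncation R n m K).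
Proof.
rewrite /truncation; elim/last_ind: (enum 'I_n) => [|s i IHs].
  exact: cst_continuous.
under eq_fun do rewrite foldl_rcons.
by apply: truncation_step_continuous => // x; exact: cvg_id.
Qed.

End Continuity.

Theorem theorem1 (R : realType) (n m : nat) (E : {set {set 'I_n}})
    (K : 'I_m -> {set 'I_n})
    (hE : edge_set E) (hK : clique_cover E K) :
  is_projection (@clique_polytope R n m K) (@truncation R n m K).
Proof.
have cov i : exists j, j \in Jset K i by exact: clique_cover_Jset hK.
split=> [x x0|x x0|].
- exact: truncation_polytope.
(* The first application lands in the polytope, whose points are all fixed. *)
- by apply: truncation_id => //; exact: truncation_polytope.
- exact/continuous_subspaceT/truncation_continuous.
Qed.
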